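(* Let $N\ge 1$, let $x_1,\dots,x_N>0$ be all distinct, and let $\mathbb{L}_N$ be the $N\times N$ matrix with entries $(\mathbb{L}_N)_{ii}=\frac{(N-1)x_i}{N}$ and $(\mathbb{L}_N)_{ij}=-\frac{x_i}{N}$ for $i\neq j$. Let $\mu$ be the measure on $\{1,\dots,N\}$ with $\mu(i)=x_i^{-1}$. Then $\mathbb{L}_N$ has $N$ nonnegative simple eigenvalues $0=\lambda_1<\lambda_2<\cdots<\lambda_N$ such that $$\{\lambda_1,\lambda_2,\dots,\lambda_N\}=\{\lambda\in\mathbb{C}:\ \phi(\lambda)=0\},$$ where $\phi$ is the meromorphic function $$\phi(\lambda):=\sum_{j=1}^N\frac{\lambda}{x_j-\lambda},\qquad \lambda\in\mathbb{C}.$$ If the $x_i$ are labelled such that $x_1<x_2<\cdots<x_N$, then $x_i<\lambda_{i+1}<x_{i+1}$ for $i=1,\dots,N-1$. Moreover, for any $i=1,\dots,N$, the vector $\psi^{(i)}\in\mathbb{R}^N$ defined by $$\psi^{(i)}_j:=\frac{x_j}{x_j-\lambda_i},\qquad j=1,\dots,N,$$ is an eigenvector of $\mathbb{L}_N$ with eigenvalue $\lambda_i$, and $\psi^{(1)},\dots,\psi^{(N)}$ form an orthogonal basis of $L^2(\mu)$.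
   Context: $L^2(\mu)$ denotes $\mathbb{R}^N$ with the scalar product $\langle a,b\rangle=\sum_{i=1}^N x_i^{-1}a_ib_i$. *)

(* Defs.v *)
From mathcomp Require Import all_boot all_order all_algebra.
From mathcomp Require Import complex.
From mathcomp Require Import classical_sets reals.

Set Implicit Arguments.
Unset Strict Implicit.
Unset Printing Implicit Defensive.

Import Order.TTheory GRing.Theory Num.Theory.
Local Open Scope ring_scope.
Local Open Scope complex_scope.
Local Open Scope classical_set_scope.

Definition LN (R : realType) (N : nat) (x : 'I_N -> R) : 'M[R]_N :=
  \matrix_(i, j) if i == j then (N%:R - 1) * x i / N%:R else - (x i / N%:R).

Definition mu (R : realType) (N : nat) (x : 'I_N -> R) (i : 'I_N) : R :=
  (x i)^-1.

Definition dotmu (R : realType) (N : nat) (x : 'I_N -> R) (a b : 'cV[R]_N) : R :=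
  \sum_(i < N) mu x i * a i 0 * b i 0.

(* Meaningful only off the poles [x j]: at a pole the offending summand takes
   the junk value 0. *)
Definition phi (R : realType) (N : nat) (x : 'I_N -> R) (z : R[i]) : R[i] :=
  \sum_(j < N) z / ((x j)%:C - z).

(* The poles are excluded explicitly, because of the junk values of [phi]
   there; they are genuine poles when the [x j] are nonzero and distinct. *)
Definition zeros_phi (R : realType) (N : nat) (x : 'I_N -> R) : set R[i] :=
  [set z | (forall j, z != (x j)%:C) /\ phi x z = 0].

(* The eigenvalues in the complex numbers of a real matrix. The library's
   [eigenvalue] refers to row vectors; this has no effect on the set of
   eigenvalues. *)
Definition spectrum (R : realType) (N : nat) (A : 'M[R]_N) : set R[i] :=
  [set z | eigenvalue (map_mx (real_complex R) A) z].

(* Unlike the library's [eigenspace], this is about column vectors. *)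
Definition eigenvector (R : realType) (N : nat) (A : 'M[R]_N) (a : R)
    (v : 'cV[R]_N) : Prop :=
  v != 0 /\ A *m v = a *: v.

Definition simple_eigenvalue (R : realType) (N : nat) (A : 'M[R]_N) (a : R) :
    Prop :=
  eigenvalue A a /\ mup a (char_poly A) = 1%N.

Definition psi (R : realType) (N : nat) (x : 'I_N -> R) (a : R) : 'cV[R]_N :=
  \col_j (x j / (x j - a)).

Definition orthogonal_basis (R : realType) (N : nat) (x : 'I_N -> R)
    (v : 'I_N -> 'cV[R]_N) : Prop :=
  basis_of fullv [seq v i | i : 'I_N] /\
  (forall i j : 'I_N, i != j -> dotmu x (v i) (v j) = 0).

(* Main.v *)
Require Import Defs.
From mathcomp Require Import all_boot all_order all_algebra.
From mathcomp Require Import complex polyrcf ring.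
From mathcomp Require Import classical_sets reals.

Import Order.TTheory GRing.Theory Num.Theory.
Local Open Scope ring_scope.
Local Open Scope complex_scope.
Local Open Scope classical_set_scope.

(** Write [P] for the polynomial [prod_j ('X - x_j)].  Its logarithmic derivative
    is [sum_j 1 / (z - x_j)], so that off the poles [phi z = - z P'(z) / P(z)]:
    the zeros of [phi] are [0] and the critical points of [P]
    ([secular_critical]).  By Rolle's theorem, [P'] vanishes strictly between
    any two consecutive roots of [P].  Together with [0], which lies to the left
    of all the [x_j], this gives [N] zeros of [phi] that interlace with the
    [x_j] ([interlacing_roots]).

    The matrix is [D (1 - J / N)], where [D] is the diagonal matrix of the [x_j]
    and [J / N] takes the mean of a vector.  The vector [psi] attached to a
    parameter [z] has entries [x_j / (x_j - z) = 1 + z / (x_j - z)], hence mean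
    [1 + phi z / N].  If [phi z = 0], this mean is [1], and subtracting it leaves
    [z / (x_j - z)], which [D] turns into [z psi_j]: the vector is an eigenvector
    ([meanfield_secular]).  So there are [N] distinct eigenvalues and the
    characteristic polynomial is the product of the corresponding linear
    factors, which gives simplicity and leaves no room for a further complex
    eigenvalue.  The same eigenvector computation, done over the complex numbers,
    shows that any complex zero of [phi] is an eigenvalue, hence one of the real
    zeros found above.

    Orthogonality comes from partial fractions: [(a - b) <psi_a, psi_b>] is
    [phi a - phi b] ([dotmu_psi]).  Nonzero orthogonal vectors for a positive
    definite scalar product are free, and [N] of them form a basis. *)

(** * The matrix and its eigenvectors over a field *)

(** [LN], [phi] and [psi] are stated over an arbitrary field, so that the same
    computation serves for real eigenvectors and for complex zeros of [phi]. *)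
Definition meanfield_mx {F : fieldType} {N : nat} (y : 'I_N -> F) : 'M[F]_N :=
  \matrix_(i, j) if i == j then (N%:R - 1) * y i / N%:R else - (y i / N%:R).

Definition secular {F : fieldType} {N : nat} (y : 'I_N -> F) (z : F) : F :=
  \sum_(j < N) z / (y j - z).

Definition secular_vec {F : fieldType} {N : nat} (y : 'I_N -> F) (z : F) :
    'cV[F]_N :=
  \col_j (y j / (y j - z)).

(** [eigenvalue] speaks of row vectors; a column eigenvector serves as well
    because a matrix and its transpose have the same characteristic
    polynomial. *)
Lemma eigenvalue_col {F : fieldType} {N : nat} (A : 'M[F]_N) (a : F)
    (v : 'cV[F]_N) :
  v != 0 -> A *m v = a *: v -> eigenvalue A a.
Proof.
move=> v0 Av; rewrite eigenvalue_root_char.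
have : eigenvalue A^T a.
  apply/eigenvalueP; exists v^T; last by rewrite -(inj_eq trmx_inj) trmxK trmx0.
  by rewrite -trmx_mul Av linearZ.
rewrite eigenvalue_root_char.
suff -> : char_poly A^T = char_poly A by [].
by rewrite /char_poly -det_tr /char_poly_mx linearB /= tr_scalar_mx map_trmx trmxK.
Qed.

Lemma char_poly_distinct_eigenvalues {F : fieldType} {N : nat} (A : 'M[F]_N)
    (lam : 'I_N -> F) :
  injective lam -> (forall i, eigenvalue A (lam i)) ->
  char_poly A = \prod_(i < N) ('X - (lam i)%:P).
Proof.
move=> lam_inj eig.
have := @all_roots_prod_XsubC _ (char_poly A) (codom lam).
rewrite size_char_poly size_map size_enum_ord (monicP (char_poly_monic A)).
rewrite scale1r big_map big_enum /= => -> //.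
- by apply/allP => _ /codomP[i ->]; rewrite -eigenvalue_root_char.
- by rewrite uniq_rootsE /codom map_inj_uniq ?enum_uniq.
Qed.

Lemma meanfield_mxE {F : numFieldType} {N : nat} (y : 'I_N -> F)
    (v : 'cV[F]_N) (i : 'I_N) :
  (meanfield_mx y *m v) i 0 = y i * (v i 0 - (\sum_j v j 0) / N%:R).
Proof.
have N0 : N%:R != 0 :> F by rewrite pnatr_eq0 -lt0n (leq_ltn_trans _ (ltn_ord i)).
rewrite mxE (bigD1 i) //= [in RHS](bigD1 i) //= mxE eqxx.
rewrite (eq_bigr (fun j => - (y i / N%:R) * v j 0)); last first.
  by move=> j ij; rewrite mxE eq_sym (negbTE ij).
rewrite -mulr_sumr.
by field.
Qed.

(** The vector has mean [1] exactly when [z] is a zero of [secular y], and then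
    subtracting the mean from [y j / (y j - z)] leaves [z / (y j - z)]. *)
Lemma meanfield_secular {F : numFieldType} {N : nat} (y : 'I_N -> F) (z : F) :
  (forall j, y j != z) -> secular y z = 0 ->
  meanfield_mx y *m secular_vec y z = z *: secular_vec y z.
Proof.
move=> yz z0; apply/colP => i; rewrite meanfield_mxE.
have N0 : N%:R != 0 :> F by rewrite pnatr_eq0 -lt0n (leq_ltn_trans _ (ltn_ord i)).
have yz0 j : y j - z != 0 by rewrite subr_eq0.
have -> : \sum_j secular_vec y z j 0 = N%:R.
  rewrite (eq_bigr (fun j => 1 + z / (y j - z))); last first.
    by move=> j _; rewrite mxE; field.
  by rewrite big_split /= -/(secular y z) z0 addr0 sumr_const card_ord.
by rewrite !mxE; field; rewrite yz0 N0.
Qed.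

Lemma secular_vec_neq0 {F : fieldType} {N : nat} (hN : (0 < N)%N)
    (y : 'I_N -> F) (z : F) :
  (forall j, y j != 0) -> (forall j, y j != z) -> secular_vec y z != 0.
Proof.
move=> y0 yz; apply/eqP => /colP /(_ (Ordinal hN)) /eqP.
by rewrite !mxE mulf_eq0 invr_eq0 subr_eq0 (negbTE (y0 _)) (negbTE (yz _)).
Qed.

(** * Zeros of the secular function *)

Lemma horner_deriv_prod {F : fieldType} {N : nat} (y : 'I_N -> F) (z : F) :
  (forall j, y j != z) ->
  (\prod_(j < N) ('X - (y j)%:P))^`().[z] =
  (\prod_(j < N) (z - y j)) * \sum_(j < N) (z - y j)^-1.
Proof.
move=> yz.
rewrite (_ : \prod_j (z - y j) = (\prod_j ('X - (y j)%:P)).[z]); last first.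
  by rewrite horner_prod; apply: eq_bigr => j _; rewrite !hornerE.
elim: (index_enum _) => [|j s IH]; first by rewrite !big_nil derivC hornerC mulr0.
have zy : z - y j != 0 by rewrite subr_eq0 eq_sym.
rewrite !big_cons derivM derivXsubC mul1r !hornerE IH.
by field.
Qed.

Lemma secular_critical {F : fieldType} {N : nat} (y : 'I_N -> F) (z : F) :
  (forall j, y j != z) -> (\prod_(j < N) ('X - (y j)%:P))^`().[z] = 0 ->
  secular y z = 0.
Proof.
move=> yz /eqP; rewrite horner_deriv_prod // mulf_eq0 => /orP[|/eqP sum0].
  by move=> /prodf_eq0[j _]; rewrite subr_eq0 eq_sym (negbTE (yz j)).
rewrite /secular (eq_bigr (fun j => - z * (z - y j)^-1)).
  by rewrite -mulr_sumr sum0 mulr0.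
by move=> j _; rewrite -[y j - z]opprB invrN mulrN mulNr.
Qed.

(** The [x_j] are sorted into a list [s].  The first zero is [0], and the zero of
    index [k.+1] is a critical point of [P] that Rolle's theorem yields strictly
    between [s`_k] and [s`_k.+1]; the zeros are therefore increasing and avoid
    the poles. *)
Lemma interlacing_roots {R : realType} {N : nat} (hN : (0 < N)%N)
    (x : 'I_N -> R) :
  (forall i, 0 < x i) -> injective x ->
  exists lam : 'I_N -> R,
    [/\ lam (Ordinal hN) = 0,
        (forall i j : 'I_N, (i < j)%N -> lam i < lam j),
        (forall i j, x j != lam i),
        (forall i, secular x (lam i) = 0) &
        ((forall i j : 'I_N, (i < j)%N -> x i < x j) ->
         forall i j : 'I_N, nat_of_ord j = i.+1 -> x i < lam j < x j)].
Proof.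
move=> x_gt0 x_inj.
pose s := sort <=%O (codom x).
have s_lt : sorted <%O s.
  by rewrite sort_lt_sorted /codom map_inj_uniq ?enum_uniq.
have sz : size s = N by rewrite size_sort size_map size_enum_ord.
have s_mono (i j : nat) : (i < j)%N -> (j < N)%N -> s`_i < s`_j.
  by move=> ij jN; rewrite (lt_sorted_ltn_nth 0 s_lt) // ?inE sz // (ltn_trans ij).
have s_le (i j : nat) : (i <= j)%N -> (j < N)%N -> s`_i <= s`_j.
  by rewrite leq_eqVlt => /orP[/eqP -> //|ij jN]; rewrite ltW ?s_mono.
have s_mem (i : nat) : (i < N)%N -> exists k, s`_i = x k.
  move=> iN; have : s`_i \in s by rewrite mem_nth ?sz.
  by rewrite mem_sort => /codomP.
have x_mem j : exists2 k : nat, (k < N)%N & x j = s`_k.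
  have : x j \in s by rewrite mem_sort codom_f.
  by move=> /(nthP 0)[k]; rewrite sz; exists k.
pose P := \prod_(j < N) ('X - (x j)%:P).
have Ps0 (i : nat) : (i < N)%N -> P.[s`_i] = 0.
  move=> /s_mem[k ->]; rewrite horner_prod (bigD1 k) //=.
  by rewrite !hornerE subrr mul0r.
have [lam lamP] : exists lam : 'I_N -> R, forall i : 'I_N,
    if (i : nat) is k.+1 then s`_k < lam i < s`_i /\ P^`().[lam i] = 0
    else lam i = 0.
  apply: (@fin_all_exists _ (fun=> R) (fun (i : 'I_N) l => if (i : nat) is k.+1
    then s`_k < l < s`_i /\ P^`().[l] = 0 else l = 0)).
  move=> [[|k] kN] /=; first by exists 0.
  have [||c cI Pc0] := @poly_rolle R s`_k s`_k.+1 P; first exact: s_mono.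
    by rewrite !Ps0 // ltnW.
  by exists c; split=> //; move: cI; rewrite in_itv.
have s_gt0 (i : nat) : (i < N)%N -> 0 < s`_i by move=> /s_mem[k ->].
have lam_lt (i : 'I_N) (k : nat) : (i <= k)%N -> (k < N)%N -> lam i < s`_k.
  move=> ik kN; apply: lt_le_trans (s_le _ _ ik kN).
  have := lamP i; case: i {ik} => [[|i] iN] /=; first by move=> ->; exact: s_gt0.
  by case=> /andP[].
have lam_gt (i : 'I_N) (k : nat) : (k < i)%N -> s`_k < lam i.
  have := lamP i; case: i => [[|i] iN] //= [/andP[il _] _] ki.
  by apply: le_lt_trans il; apply: s_le => //; exact: ltnW.
have lam_x i j : x j != lam i.
  have [k kN ->] := x_mem j; have [ik|ki] := leqP i k.
    by rewrite gt_eqF ?lam_lt.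
  by rewrite lt_eqF ?lam_gt.
exists lam; split=> //.
- exact: (lamP (Ordinal hN)).
- by move=> i j ij; apply: lt_trans (lam_lt i i (leqnn i) (ltn_ord i)) (lam_gt j i ij).
- move=> i; have := lamP i; have := lam_x i.
  case: i => [[|i] iN] /= lx; last by case=> _; apply: secular_critical.
  by move=> ->; rewrite /secular big1 // => j _; rewrite mul0r.
- move=> x_incr i j ji.
  have codom_nth (k : 'I_N) : (codom x)`_k = x k.
    by rewrite (nth_map k) ?size_enum_ord // nth_ord_enum.
  (* For an increasing family, sorting changes nothing: two strictly sorted
     lists with the same elements are equal. *)
  have codomE : codom x = s.
    apply: lt_sorted_eq => //; last by move=> z; rewrite mem_sort.
    apply/(sortedP 0) => k; rewrite size_map size_enum_ord => k1N.
    have := codom_nth (Ordinal k1N); have := codom_nth (Ordinal (ltnW k1N)).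
    by move=> /= -> ->; rewrite x_incr.
  have xE k : x k = s`_k by rewrite -codomE codom_nth.
  by rewrite !xE lam_lt // lam_gt // ji.
Qed.

(** * Orthogonality *)

(** Partial fractions: [(a - b) y / ((y - a) (y - b)) = a / (y - a) - b / (y - b)]. *)
Lemma dotmu_psi {R : realType} {N : nat} (x : 'I_N -> R) (a b : R) :
  (forall j, x j != 0) -> (forall j, x j != a) -> (forall j, x j != b) ->
  (a - b) * dotmu x (psi x a) (psi x b) = secular x a - secular x b.
Proof.
move=> x0 xa xb; rewrite /dotmu mulr_sumr -sumrB; apply: eq_bigr => j _.
rewrite !mxE /mu; field.
by rewrite x0 !subr_eq0 xa xb.
Qed.

Lemma dotmu_gt0 {R : realType} {N : nat} (x : 'I_N -> R) (v : 'cV[R]_N) :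
  (forall j, 0 < x j) -> v != 0 -> 0 < dotmu x v v.
Proof.
move=> x0 v0.
have ge0 j : 0 <= mu x j * v j 0 * v j 0.
  by rewrite -mulrA -expr2 mulr_ge0 ?invr_ge0 ?sqr_ge0 ?ltW.
rewrite lt0r sumr_ge0 // andbT psumr_eq0 //.
apply: contra v0 => /allP v0; apply/eqP/colP => j.
move: (v0 j); rewrite mem_index_enum => /(_ isT); rewrite !mulf_eq0 mxE.
by rewrite invr_eq0 gt_eqF //= orbb => /eqP.
Qed.

Lemma orthogonal_basis_of {R : realType} {N : nat} (x : 'I_N -> R)
    (v : 'I_N -> 'cV[R]_N) :
  (forall j, 0 < x j) -> (forall i, v i != 0) ->
  (forall i j, i != j -> dotmu x (v i) (v j) = 0) -> orthogonal_basis x v.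
Proof.
move=> x0 v0 orth; split=> //.
have szv : size [seq v i | i : 'I_N] == N by rewrite size_map size_enum_ord.
rewrite basisEfree subvf dimvf dim_matrix (eqP szv) -[GRing.mul _ _]/(muln _ _) muln1 leqnn !andbT.
rewrite -[X in free X]/(tval (Tuple szv)); apply/freeP => k sum0 i.
have nthv (j : 'I_N) : [seq v i | i : 'I_N]`_j = v j.
  by rewrite (nth_map i) ?size_enum_ord // nth_ord_enum.
have /eqP : dotmu x (\sum_j k j *: (Tuple szv)`_j) (v i) = 0.
  by rewrite sum0 /dotmu big1 // => j _; rewrite mxE mulr0 mul0r.
suff -> : dotmu x (\sum_j k j *: (Tuple szv)`_j) (v i)
          = k i * dotmu x (v i) (v i).
  by rewrite mulf_eq0 [X in _ || X]gt_eqF ?dotmu_gt0 // orbF => /eqP.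
(* Pairing a vanishing combination with [v i] isolates its [i]-th coefficient. *)
transitivity (\sum_j k j * dotmu x (v j) (v i)); last first.
  by rewrite (bigD1 i) //= big1 ?addr0 // => j ji; rewrite orth ?mulr0.
under [RHS]eq_bigr do rewrite /dotmu mulr_sumr.
rewrite exchange_big /=; apply: eq_bigr => l _.
rewrite summxE mulr_sumr mulr_suml; apply: eq_bigr => j _.
by rewrite nthv mxE; ring.
Qed.

(** * Real and complex spectrum *)

Lemma map_meanfield_mx {R : realType} {N : nat} (x : 'I_N -> R) :
  map_mx (real_complex R) (LN x) = meanfield_mx (fun j => (x j)%:C).
Proof.
apply/matrixP => i j; rewrite !mxE; case: eqP => _.
  by rewrite rmorphM rmorphM rmorphB fmorphV rmorph_nat rmorph1.
by rewrite rmorphN rmorphM fmorphV rmorph_nat.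
Qed.

Lemma phi_real {R : realType} {N : nat} (x : 'I_N -> R) (a : R) :
  phi x a%:C = (secular x a)%:C.
Proof.
rewrite /secular rmorph_sum; apply: eq_bigr => j _.
by rewrite rmorphM fmorphV rmorphB.
Qed.

Theorem proposition2p1 (R : realType) (N : nat) (hN : (0 < N)%N)
    (x : 'I_N -> R) (x_gt0 : forall i : 'I_N, 0 < x i) (x_inj : injective x) :
  exists lam : 'I_N -> R,
    lam (Ordinal hN) = 0
    /\ (forall i j : 'I_N, (i < j)%N -> lam i < lam j)
    /\ (forall i : 'I_N, simple_eigenvalue (LN x) (lam i))
    /\ spectrum (LN x) = [set (lam i)%:C | i in [set: 'I_N]]
    /\ [set (lam i)%:C | i in [set: 'I_N]] = zeros_phi x
    /\ ((forall i j : 'I_N, (i < j)%N -> x i < x j) ->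
        forall i j : 'I_N, nat_of_ord j = i.+1 -> x i < lam j < x j)
    /\ (forall i : 'I_N, eigenvector (LN x) (lam i) (psi x (lam i)))
    /\ orthogonal_basis x (fun i : 'I_N => psi x (lam i)).
Proof.
have [lam [lam0 lam_incr lam_x lam_sec lam_int]] :=
  interlacing_roots hN x x_gt0 x_inj.
have x_neq0 j : x j != 0 by rewrite gt_eqF.
have lam_inj : injective lam.
  move=> i j lij; apply/val_inj/eqP; case: ltngtP => //= /lam_incr;
  by rewrite lij ltxx.
have psi_neq0 i : psi x (lam i) != 0 by exact: secular_vec_neq0.
have psi_eig i : LN x *m psi x (lam i) = lam i *: psi x (lam i).
  exact: meanfield_secular.
have lam_eig i : eigenvalue (LN x) (lam i) by exact: eigenvalue_col (psi_eig i).
have charE := char_poly_distinct_eigenvalues (LN x) lam lam_inj lam_eig.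
have specE : spectrum (LN x) = [set (lam i)%:C | i in [set: 'I_N]].
  apply/seteqP; split=> [z|_ [i _ <-]] /=.
    rewrite /spectrum /= eigenvalue_root_char -map_char_poly charE.
    rewrite map_prod_XsubC rootE horner_prod => /prodf_eq0[i _].
    by rewrite !hornerE subr_eq0 => /eqP ->; exists i.
  rewrite /spectrum /= eigenvalue_root_char -map_char_poly rootE horner_map.
  by move: (lam_eig i); rewrite eigenvalue_root_char rootE => /eqP ->; rewrite rmorph0.
exists lam; do 3 split=> //.
  split=> //; rewrite charE.
  have -> : \prod_j ('X - (lam j)%:P) = \prod_(a <- codom lam) ('X - a%:P).
    by rewrite big_map big_enum.
  rewrite mu_prod_XsubC count_uniq_mem ?codom_f //.
  by rewrite /codom map_inj_uniq ?enum_uniq.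
split=> //; split; last split=> //; last split=> //.
- apply/seteqP; split=> [_ [i _ <-]|z [zx z0]].
    split=> [j|]; last by rewrite phi_real lam_sec rmorph0.
    by rewrite eq_sym (inj_eq (@complexI _)).
  rewrite -specE /spectrum /= map_meanfield_mx.
  have xz j : (x j)%:C != z by rewrite eq_sym.
  apply: eigenvalue_col (meanfield_secular _ z xz z0).
  by apply: secular_vec_neq0 => // j; rewrite (inj_eq (@complexI _) _ 0).
- apply: orthogonal_basis_of => // i j ij.
  have /eqP := dotmu_psi x (lam i) (lam j) x_neq0 (lam_x i) (lam_x j).
  rewrite !lam_sec subrr mulf_eq0 subr_eq0 (inj_eq lam_inj) (negbTE ij) /=.
  by move/eqP.
Qed.
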